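(* Let $\mathcal{F}$ be a difference field, $y$ a difference indeterminate over $\mathcal{F}$, and let $\mathbb{G}=\{g_1,\dots,g_t\}\subset\mathbb{Z}[x]$, with $g_1<\cdots<g_t$, be a reduced Gröbner basis of the $\mathbb{Z}[x]$-module (ideal) $L=(\mathbb{G})_{\mathbb{Z}[x]}\subset\mathbb{Z}[x]$. Let $\mathcal{I}_{\mathbb{G}}$ be the difference ideal of $\mathcal{F}\{y\}$ generated by all $y^{g^+}-y^{g^-}$ with $g\in L$, $\mathrm{lc}(g)>0$, and let $L_i=\{f\in L\mid \mathrm{lc}(f)=\mathrm{lc}(g_t)\}$. Then $\mathcal{I}_{\mathbb{G}}$ has a finite $\sigma$-Gröbner basis if and only if $L_i\cap\Phi_0\neq\emptyset$.
   Context: A difference field ($\sigma$-field) is a field $\mathcal{F}$ with an injective ring endomorphism $\sigma$. $\mathcal{F}\{y\}=\mathcal{F}[y,\sigma(y),\sigma^2(y),\dots]$. For $p=\sum_{i=0}^s c_ix^i\in\mathbb{N}[x]$ ($\mathbb{N}$ contains $0$) and an element $a$, write $a^p=\prod_{i=0}^s(\sigma^i(a))^{c_i}$; so $a^{x^m}=\sigma^m(a)$, and the monomials of $\mathcal{F}\{y\}$ are exactly the $y^p$ with $p\in\mathbb{N}[x]$. A difference ideal ($\sigma$-ideal) is an ideal $\mathcal{I}$ (possibly infinitely generated) with $\sigma(\mathcal{I})\subset\mathcal{I}$; the $\sigma$-ideal generated by a set is the smallest $\sigma$-ideal containing it. The monomial order on $\mathcal{F}\{y\}$ is compatible with the $\sigma$-structure: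 $y^{x^{k_1}}<y^{x^{k_2}}$ for $k_1<k_2$, and $y^{h^+}>y^{h^-}$ for every $h\in\mathbb{Z}[x]$ with $\mathrm{lc}(h)>0$ (i.e. it is the lexicographic order with $y<y^x<y^{x^2}<\cdots$). $\mathbf{LM}(P)$ is the largest monomial of $P$. A set $\mathbb{H}\subset\mathcal{I}$ is a $\sigma$-Gröbner basis of a $\sigma$-ideal $\mathcal{I}$ if for every nonzero $P\in\mathcal{I}$ there are $m\in\mathbb{N}$ and $H\in\mathbb{H}$ with $(\mathbf{LM}(H))^{x^m}\mid\mathbf{LM}(P)$. For $h\in\mathbb{Z}[x]$, $\mathrm{lc}(h)$ and $\mathrm{lt}(h)$ denote the leading coefficient and leading term, and $h^+,h^-\in\mathbb{N}[x]$ are the positive and negative parts, $h=h^+-h^-$ with no monomial occurring in both. $\Phi_0=\{h\in\mathbb{Z}[x]\mid \mathrm{lt}(h)=h^+\}$. Gröbner basis of a nonzero ideal $L$ of $\mathbb{Z}[x]$: a finite set $\mathbb{G}\subset L$ of polynomials with positive leading coefficients such that the leading term of every nonzero element of $L$ is divisible (in $\mathbb{Z}[x]$) by $\mathrm{lt}(g)$ for some $g\in\mathbb{G}$; it is reduced if no $\mathrm{lt}(g_i)$ is divisible by another $\mathrm{lt}(g_j)$ and, for $j\ne i$ and every non-leading exponent $e\geq\deg g_j$, the coefficient of $x^e$ in $g_i$ lies in $[0,\mathrm{lc}(g_j))$. Writing $\mathrm{lt}(g_i)=c_ix^{d_i}$ in increasing order one has $d_1<\cdots<d_t$, $c_t\mid\cdots\mid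 c_1$ and $c_i\neq c_{i+1}$. *)

(* Defs.v *)
From HB Require Import structures.
From mathcomp Require Import all_boot all_order all_algebra.
From mathcomp Require Import finmap.
From mathcomp Require Import monalg.

Set Implicit Arguments.
Unset Strict Implicit.
Unset Printing Implicit Defensive.

Import Order.TTheory GRing.Theory Num.Theory.

Local Open Scope ring_scope.

(* Divisibility in Z[x] itself: the library's [%|] on [{poly int}] is
   pseudo-divisibility, for which [2 * 'X] divides ['X]. *)
Definition zdvd (p q : {poly int}) : Prop := exists r : {poly int}, q = r * p.

(* [size p] is the degree plus one; [lt_of 0 = 0]. *)
Definition lt_of (h : {poly int}) : {poly int} :=
  lead_coef h *: 'X^((size h).-1).

(* The total order of Z[x] underlying the monomial order on F{y}:
   y^(h^-) < y^(h^+) iff lc(h) > 0. *)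
Definition zlt (f g : {poly int}) : bool := 0 < lead_coef (g - f).

Definition pos_part (h : {poly int}) : {poly nat} :=
  \poly_(i < size h) (if 0 <= h`_i then absz h`_i else 0%N).

Definition neg_part (h : {poly int}) : {poly nat} := pos_part (- h).

Definition Phi0 (h : {poly int}) : Prop :=
  lt_of h = map_poly Posz (pos_part h).

Definition ideal_gen (G : seq {poly int}) (f : {poly int}) : Prop :=
  exists a : 'I_(size G) -> {poly int}, f = \sum_(i < size G) a i * G`_i.

Definition groebner (L : {poly int} -> Prop) (G : seq {poly int}) : Prop :=
  [/\ exists2 f, L f & f != 0,
      forall g, g \in G -> L g /\ 0 < lead_coef g
    & forall f, L f -> f != 0 -> exists2 g, g \in G & zdvd (lt_of g) (lt_of f)].

Definition reduced_groebner (L : {poly int} -> Prop) (G : seq {poly int}) :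
    Prop :=
  groebner L G /\
  forall g h, g \in G -> h \in G -> g != h ->
    ~ zdvd (lt_of h) (lt_of g) /\
    forall e : nat, ((size h).-1 <= e)%N -> e != (size g).-1 ->
      0 <= g`_e < lead_coef h.

(* F{y} is the polynomial ring in the indeterminates y_i = sigma^i(y), i : nat;
   [m : {cmonom nat}] stands for the product of the y_i ^+ m i. *)
Notation dpoly F := {malg F[{cmonom nat}]}.

(* sigma on monomials: the exponent of y_(i+1) in [mshift m] is [m i]. *)
Definition mshift (m : {cmonom nat}) : {cmonom nat} :=
  [cmonom m i.-1 | i in [fset j.+1 | j in finsupp m]]%M.

Lemma mshift0 m : mshift m 0%N = 0%N.
Proof. by rewrite cmE fsfun_fun; case: imfsetP => [[]|]. Qed.

Lemma mshiftS m i : mshift m i.+1 = m i.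
Proof.
rewrite cmE fsfun_fun /=; case: imfsetP => [//|nim].
by case: (finsuppP m i) => // im; case: nim; exists i.
Qed.

Lemma malgUM (K : monomType) (R : ringType) (m n : K) :
  (<< m >> * << n >> : {malg R[K]}) = << mmul m n >>.
Proof. by rewrite malgME !msuppU1 !big_seq_fset1 !mcoeffUU mulr1. Qed.

Definition dshift (F : fieldType) (m : {cmonom nat}) : dpoly F :=
  << mshift m >>.

Fact dshift_mmorphism (F : fieldType) : mmorphism (@dshift F).
Proof.
have mshift1 : mshift mone = mone.
  by apply/eqP/cmP=> -[|i]; rewrite cm1 ?mshift0 // mshiftS cm1.
have mshiftM m n : mshift (mmul m n) = mmul (mshift m) (mshift n).
  by apply/eqP/cmP=> -[|i]; rewrite cmM ?mshift0 // !mshiftS cmM.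
split=> [m n|]; rewrite /dshift ?mshift1 ?mshiftM //.
by rewrite malgUM.
Qed.

HB.instance Definition _ (F : fieldType) :=
  isMultiplicative.Build {cmonom nat} (dpoly F) (@dshift F)
    (@dshift_mmorphism F).

(* The difference structure of F is a ring endomorphism [sigma]; it is
   injective because F is a field ([fmorph_inj]).  [dsigma sigma] is its
   extension to F{y} with y_i |-> y_(i+1). *)
Definition dsigma (F : fieldType) (sigma : {rmorphism F -> F}) :
    dpoly F -> dpoly F :=
  mmap (@malgC {cmonom nat} F \o sigma) (@dshift F).

HB.instance Definition _ (F : fieldType) (sigma : {rmorphism F -> F}) :=
  GRing.RMorphism.copy (dsigma sigma)
    (mmap (@malgC {cmonom nat} F \o sigma) (@dshift F)).

Lemma dsigmaC (F : fieldType) (sigma : {rmorphism F -> F}) c :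
  dsigma sigma c%:MP = (sigma c)%:MP.
Proof. exact: mmapC. Qed.

Lemma dsigmaU (F : fieldType) (sigma : {rmorphism F -> F}) i :
  dsigma sigma << ucm i >> = << ucm i.+1 >>.
Proof.
have -> : ucm i.+1 = mshift (ucm i).
  by apply/eqP/cmP=> -[|j]; rewrite ?mshift0 ?mshiftS !ucmE.
apply: etrans (mmapU _ _) _; rewrite /= rmorph1.
exact: mul1r.
Qed.

Definition dvar (F : fieldType) : dpoly F := << ucm 0%N >>.

(* a^p for p in N[x]. *)
Definition dpow (R : comNzRingType) (s : R -> R) (a : R) (p : {poly nat}) : R :=
  \prod_(i < size p) iter i s a ^+ (p`_i)%R.

Definition sigma_ideal (R : comNzRingType) (s : R -> R) (I : R -> Prop) : Prop :=
  [/\ I 0,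
      forall a b, I a -> I b -> I (a + b),
      forall a b, I b -> I (a * b)
    & forall a, I a -> I (s a)].

Definition sigma_ideal_gen (R : comNzRingType) (s : R -> R) (S : R -> Prop)
    (a : R) : Prop :=
  forall I : R -> Prop, sigma_ideal s I -> (forall b, S b -> I b) -> I a.

Definition mnm_lt (m1 m2 : {cmonom nat}) : Prop :=
  exists k, (m1 k < m2 k)%N /\ forall j, (k < j)%N -> m1 j = m2 j.

Definition mnm_dvd (m1 m2 : {cmonom nat}) : Prop :=
  exists u : {cmonom nat}, m2 = mmul u m1.

(* [is_LM P m] says that m = LM(P); it never holds when P = 0. *)
Definition is_LM (F : fieldType) (P : dpoly F) (m : {cmonom nat}) : Prop :=
  m \in msupp P /\ forall n, n \in msupp P -> n = m \/ mnm_lt n m.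

Definition sigma_groebner (F : fieldType) (I H : dpoly F -> Prop) : Prop :=
  (forall h, H h -> I h) /\
  forall P, I P -> P != 0 ->
    exists h mh mP, exists k : nat,
      [/\ H h, is_LM h mh, is_LM P mP & mnm_dvd (iter k mshift mh) mP].

Definition lattice_sigma_ideal (F : fieldType) (sigma : {rmorphism F -> F})
    (L : {poly int} -> Prop) : dpoly F -> Prop :=
  sigma_ideal_gen (dsigma sigma) (fun P => exists g : {poly int},
    [/\ L g, 0 < lead_coef g
      & P = dpow (dsigma sigma) (dvar F) (pos_part g)
            - dpow (dsigma sigma) (dvar F) (neg_part g)]).

(* Main.v *)
(* Write c for the leading coefficient of g_t; it divides every leading
   coefficient of L.  Coefficients of an element of I_G add up to 0 over each
   class of monomials modulo L, so the leading monomials of I_G are the multiples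
   of the y^(g^+) with g in L and lc(g) > 0.  If f = c x^d - n with n in N[x] lies
   in L, then y^(f^+) accounts, up to shifts, for all such g of degree at least d,
   and Dickson's lemma for the remaining ones.  Conversely, for N large there is
   h in L with h^+ = c x^N + s, where deg s < deg g_t and y^s is irreducible
   modulo I_G.  A shift by x^k of a basis monomial dividing y^(h^+) has to
   involve x^N, so k is large and the basis monomial is a power of a single
   variable; the element of L behind it lies in Phi_0. *)
Require Import Defs.
From mathcomp Require Import all_boot all_order all_algebra.
From mathcomp Require Import finmap monalg.
From mathcomp Require Import boolp zify.

Import GRing.Theory.
Local Open Scope ring_scope.

Set Implicit Arguments.
Unset Strict Implicit.
Unset Printing Implicit Defensive.

Import Order.TTheory Num.Theory.

(** * Ideals of Z[x], and monomials as exponent polynomials *)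

Definition zideal (L : {poly int} -> Prop) : Prop :=
  [/\ L 0, forall f g, L f -> L g -> L (f + g)
    & forall a f, L f -> L (a * f)].

Lemma zidealN L f : zideal L -> L f -> L (- f).
Proof. by case=> _ _ LM Lf; rewrite -mulN1r; apply: LM. Qed.

Lemma zidealB L f g : zideal L -> L f -> L g -> L (f - g).
Proof.
by move=> LI Lf Lg; case: (LI) => _ LD _; apply: LD => //; exact: zidealN.
Qed.

Lemma ideal_gen_zideal G : zideal (ideal_gen G).
Proof.
split=> [|f g [a ->] [b ->]|c f [a ->]].
- by exists (fun=> 0); rewrite big1 // => i _; rewrite mul0r.
- exists (fun i => a i + b i); rewrite -big_split /=.
  by apply: eq_bigr => i _; rewrite mulrDl.
- exists (fun i => c * a i); rewrite mulr_sumr.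
  by apply: eq_bigr => i _; rewrite mulrA.
Qed.

(** Exponents are read in Z[x], so that the difference of two monomials can be tested for membership
    in [L]. *)
Definition pol_of (m : {cmonom nat}) : {poly int} :=
  \sum_(i <- finsupp m) (m i)%:Z *: 'X^i.

Lemma coef_pol_of m i : (pol_of m)`_i = (m i)%:Z.
Proof.
rewrite coef_sum; case: (finsuppP m i) => im.
  by rewrite big1_seq // => j /= jm; rewrite coefZ coefXn; case: eqP => [<-|];
    rewrite ?mulr0 // fsfun_dflt // mul0r.
rewrite (big_fsetD1 i) //= coefZ coefXn eqxx mulr1 big1_fset ?addr0 // => j.
by rewrite in_fsetD1 coefZ coefXn eq_sym => /andP[/negPf-> _]; rewrite mulr0.
Qed.

Lemma pol_ofM m n : pol_of (mmul m n) = pol_of m + pol_of n.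
Proof. by apply/polyP => i; rewrite coefD !coef_pol_of cmM. Qed.

Lemma pol_of_shift m : pol_of (mshift m) = 'X * pol_of m.
Proof.
apply/polyP => -[|i]; rewrite coefXM coef_pol_of /= ?mshift0 //.
by rewrite mshiftS coef_pol_of.
Qed.

Definition mon_of (p : {poly nat}) : {cmonom nat} :=
  [cmonom (p`_i)%R | i in seq_fset tt (iota 0 (size p))]%M.

Lemma mon_ofE p i : mon_of p i = p`_i.
Proof.
rewrite cmE fsfun_fun seq_fsetE mem_iota add0n /=.
by case: ltnP => // /(nth_default _) ->.
Qed.

(** The monomial y^(h^+); accordingly [pmon (- h)] is y^(h^-). *)
Definition pmon (h : {poly int}) : {cmonom nat} := mon_of (pos_part h).

Lemma pmonE h i : (pmon h i)%:Z = Num.max 0 h`_i.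
Proof.
rewrite mon_ofE coef_poly; case: ltnP => [_|/(nth_default 0)->] //.
by case: ifP; lia.
Qed.

Lemma pmonB h : pol_of (pmon h) - pol_of (pmon (- h)) = h.
Proof.
apply/polyP => i; rewrite coefB !coef_pol_of !pmonE coefN; move: (h`_i); lia.
Qed.

Lemma pmonMXn h k i :
  pmon ('X^k * h) i = if (i < k)%N then 0%N else pmon h (i - k)%N.
Proof.
have := pmonE ('X^k * h) i; rewrite coefXnM; have := pmonE h (i - k)%N;
  move: (h`_(i - k)); case: ltnP; lia.
Qed.

Lemma iter_mshift k m i :
  iter k mshift m i = if (i < k)%N then 0%N else m (i - k)%N.
Proof.
elim: k i => [|k IH] [|i] //=; first by rewrite mshift0.
by rewrite mshiftS IH ltnS subSS.
Qed.

Lemma mnm_dvdP m n : mnm_dvd m n <-> forall i, (m i <= n i)%N.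
Proof.
split=> [[u ->] i|le_mn]; first by rewrite cmM leq_addl.
exists (pmon (pol_of n - pol_of m)); apply/eqP/cmP => i; rewrite cmM.
have := pmonE (pol_of n - pol_of m) i; rewrite coefB !coef_pol_of.
by have := le_mn i; lia.
Qed.

(** * The monomial order *)

(** A coefficientwise form of the same shape as [mnm_lt]; the witness [k] is the degree. *)
Lemma lead_coef_gt0P (h : {poly int}) :
  0 < lead_coef h <-> exists k, 0 < h`_k /\ forall j, (k < j)%N -> h`_j = 0.
Proof.
split=> [h0|[k [hk0 hk]]].
  exists (size h).-1; split=> // j ltj; apply: nth_default.
  by move: ltj; case: (size h).
rewrite lead_coefE (_ : (size h).-1 = k) //.
have : (size h <= k.+1)%N by apply/leq_sizeP=> j; apply: hk.
suff ltk : (k < size h)%N.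
  move=> lek; apply/eqP.
  by rewrite -eqSS prednK ?eqn_leq ?lek // (leq_ltn_trans _ ltk).
by rewrite ltnNge; apply: contraTN hk0 => /(nth_default 0)->.
Qed.

Lemma mnm_ltP m n : mnm_lt m n <-> 0 < lead_coef (pol_of n - pol_of m).
Proof.
rewrite lead_coef_gt0P; split=> -[k [ltk eqk]]; exists k.
  rewrite coefB !coef_pol_of; split; first by lia.
  by move=> j /eqk eqj; rewrite coefB !coef_pol_of eqj subrr.
move: ltk; rewrite coefB !coef_pol_of; split; first by lia.
by move=> j /eqk; rewrite coefB !coef_pol_of; lia.
Qed.

Lemma lead_coefD_gt0 (f g : {poly int}) :
  0 < lead_coef f -> 0 < lead_coef g -> 0 < lead_coef (f + g).
Proof.
move=> /lead_coef_gt0P[k [fk fk0]] /lead_coef_gt0P[l [gl gl0]].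
apply/lead_coef_gt0P; exists (maxn k l); split.
  rewrite coefD; case: (ltngtP k l) => [lt|lt|eq_kl].
  - by rewrite fk0 // add0r.
  - by rewrite gl0 // addr0.
  - by subst l; lia.
by move=> j; rewrite gtn_max coefD => /andP[/fk0-> /gl0->].
Qed.

Lemma mnm_lt_trans m n p : mnm_lt m n -> mnm_lt n p -> mnm_lt m p.
Proof.
rewrite !mnm_ltP => mn /(lead_coefD_gt0 mn).
by rewrite addrC addrA subrK.
Qed.

Lemma mnm_lt_irr m : ~ mnm_lt m m.
Proof. by case=> k []; rewrite ltnn. Qed.

Lemma mnm_lt_total m n : m != n -> mnm_lt m n \/ mnm_lt n m.
Proof.
move=> neq; rewrite !mnm_ltP -[X in 0 < lead_coef X \/ _]opprB lead_coefN.
suff : lead_coef (pol_of m - pol_of n) != 0 by move: (lead_coef _); lia.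
rewrite lead_coef_eq0 subr_eq0; apply: contra_neq neq => eq_mn.
apply/eqP/cmP => i; have := congr1 (fun p : {poly int} => p`_i) eq_mn.
by rewrite !coef_pol_of; lia.
Qed.

(* Minimising the exponents one after the other, from the top one down. *)
Lemma mnm_lt_min_below (P : {cmonom nat} -> Prop) d u : P u ->
  exists m, [/\ P m, forall j, (d <= j)%N -> m j = u j
    & forall n, P n -> (forall j, (d <= j)%N -> n j = u j) -> ~ mnm_lt n m].
Proof.
elim: d u => [|d IH] u Pu.
  by exists u; split=> // n _ eq_nu [k []]; rewrite eq_nu // ltnn.
pose Q (v : {cmonom nat}) := P v /\ forall j, (d < j)%N -> v j = u j.
have [v [Qv minv]] : exists v, Q v /\ forall w, Q w -> (v d <= w d)%N.
  have : exists k, `[< exists2 w, Q w & w d = k >].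
    by exists (u d); apply/asboolP; exists u.
  case/ex_minnP=> k /asboolP[v Qv <-] mink; exists v; split=> // w Qw.
  by apply: mink; apply/asboolP; exists w.
have [Pv eq_vu] := Qv; have [m [Pm eq_mv minm]] := IH v Pv.
exists m; split=> // [j ltdj|n Pn eq_nu].
  by rewrite eq_mv ?eq_vu // ltnW.
have [lt_nv|le_vn] := ltnP (v d) (n d); last first.
  apply: minm => // j; rewrite leq_eqVlt => /predU1P[<-|ltdj].
    by apply/eqP; rewrite eqn_leq le_vn minv.
  by rewrite eq_nu ?eq_vu.
(* Here [n] has a larger exponent than [m] at [d] and agrees with it above, so it cannot be
   smaller. *)
case=> k [ltk eqk]; have [ltkd|ltdk|kd] := ltngtP k d.
- by move: lt_nv; rewrite eqk // eq_mv // ltnn.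
- by move: ltk; rewrite eq_nu // (eq_mv _ (ltnW ltdk)) eq_vu // ltnn.
- by move: ltk; rewrite kd eq_mv // ltnNge ltnW.
Qed.

(** A monomial smaller than one without exponents from [d] on has none there either, so the minimum
    within the first [d] variables is a minimum of all of [P]. *)
Lemma mnm_lt_min (P : {cmonom nat} -> Prop) d u :
    P u -> (forall j, (d <= j)%N -> u j = 0%N) ->
  exists m, [/\ P m, forall j, (d <= j)%N -> m j = 0%N
    & forall n, P n -> ~ mnm_lt n m].
Proof.
move=> Pu u0; have [m [Pm eq_mu minm]] := mnm_lt_min_below d Pu.
exists m; split=> // [j ledj|n Pn ltnm]; first by rewrite eq_mu ?u0.
apply: (minm n) => // j ledj; rewrite u0 //.
case: ltnm => k [ltk eqk]; have [ltkj|lejk] := ltnP k j.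
  by rewrite eqk // eq_mu ?u0.
by move: ltk; rewrite eq_mu ?u0 // (leq_trans ledj).
Qed.

(* Dickson's lemma: one basis settles the elements with a large last exponent,
   and each of the finitely many smaller values of it needs one more basis. *)
Lemma dickson (T : eqType) (e : T -> nat -> nat) d (P : T -> Prop) :
  exists s : seq T, (forall t, t \in s -> P t) /\
    forall t, P t -> exists2 u, u \in s &
      forall i, (i < d)%N -> (e u i <= e t i)%N.
Proof.
elim: d P => [|d IH] P.
  have [[t Pt]|noP] := pselect (exists t, P t).
    exists [:: t]; split=> [u|u Pu]; first by rewrite inE => /eqP->.
    by exists t; rewrite ?inE.
  by exists [::]; split=> // t Pt; case: noP; exists t.
have [s [sP sdom]] := IH P.
pose B := \max_(u <- s) e u d.
have [s' [s'P s'dom]] : exists s' : seq T, (forall t, t \in s' -> P t) /\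
    forall t, P t -> (e t d < B)%N -> exists2 u, u \in s' &
      forall i, (i <= d)%N -> (e u i <= e t i)%N.
  elim: B => [|B [s1 [s1P s1dom]]]; first by exists [::].
  have [s2 [s2P s2dom]] := IH (fun t => P t /\ e t d = B).
  exists (s1 ++ s2); split=> [t|t Pt].
    by rewrite mem_cat => /orP[/s1P|/s2P[]].
  rewrite ltnS leq_eqVlt => /predU1P[etB|].
    have [u us2 leu] := s2dom t (conj Pt etB); exists u.
      by rewrite mem_cat us2 orbT.
    move=> i; rewrite leq_eqVlt => /predU1P[->|/leu //].
    by have [_ ->] := s2P u us2; rewrite etB.
  case/(s1dom t Pt)=> u us1 leu; exists u => //.
  by rewrite mem_cat us1.
exists (s ++ s'); split=> [t|t Pt].
  by rewrite mem_cat => /orP[/sP|/s'P].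
have [/(s'dom t Pt)[u us' leu]|leB] := ltnP (e t d) B.
  by exists u => //; rewrite mem_cat us' orbT.
have [u us leu] := sdom t Pt; exists u; first by rewrite mem_cat us.
move=> i; rewrite ltnS leq_eqVlt => /predU1P[->|/leu //].
by apply: leq_trans leB; apply: leq_bigmax_seq.
Qed.

(** * Leading monomials of the lattice ideal *)

(** [C] is a union of classes modulo [L]. Single classes would not do: the preimage of a class under
    the shift may consist of several. *)
Definition saturated (L : {poly int} -> Prop) (C : pred {cmonom nat}) : Prop :=
  forall m n, L (pol_of m - pol_of n) -> C m = C n.

(** The sum of the coefficients of [P] over [C], as the linear extension of the indicator of [C]. *)
Definition class_sum (F : fieldType) (C : pred {cmonom nat}) (P : dpoly F) :
    F :=
  mmap idfun (fun m => (C m)%:R) P.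

Lemma class_sumB (F : fieldType) C (P Q : dpoly F) :
  class_sum C (P - Q) = class_sum C P - class_sum C Q.
Proof. exact: mmapB. Qed.

Lemma class_sumD (F : fieldType) C (P Q : dpoly F) :
  class_sum C (P + Q) = class_sum C P + class_sum C Q.
Proof. exact: mmapD. Qed.

Lemma class_sum_sum (F : fieldType) C I (r : seq I) (f : I -> dpoly F) :
  class_sum C (\sum_(i <- r) f i) = \sum_(i <- r) class_sum C (f i).
Proof. exact: (raddf_sum (mmap idfun (fun m => (C m)%:R))). Qed.

Lemma class_sumU (F : fieldType) C (c : F) m :
  class_sum C << c *g m >> = c * (C m)%:R.
Proof. exact: mmapU. Qed.

Lemma class_sumE (F : fieldType) C (P : dpoly F) :
  class_sum C P = \sum_(m <- msupp P) P@_m * (C m)%:R.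
Proof. exact: mmapE. Qed.

Lemma malgUUM (F : fieldType) (c d : F) (m n : {cmonom nat}) :
  << c *g m >> * << d *g n >> = << c * d *g mmul m n >> :> dpoly F.
Proof. by rewrite malgM_def fgmulUU. Qed.

Lemma class_sumM (F : fieldType) C (P Q : dpoly F) :
  class_sum C (P * Q)
    = \sum_(m <- msupp P) P@_m * class_sum (fun n => C (mmul m n)) Q.
Proof.
rewrite {1}(monalgE P) {1}(monalgE Q) mulr_suml class_sum_sum.
apply: eq_bigr => m _; rewrite mulr_sumr class_sum_sum class_sumE mulr_sumr.
by apply: eq_bigr => n _; rewrite malgUUM class_sumU mulrA.
Qed.

Lemma scale_malgU (K : monomType) (R : nzRingType) (c : R) (k : K) :
  c *: << k >> = << c *g k >> :> {malg R[K]}.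
Proof. by apply/malgP => l; rewrite mcoeffZ !mcoeffU mulr_natr. Qed.

Lemma msupp_malgUB (K : monomType) (R : nzRingType) (k l : K) :
  l != k -> k \in msupp (<< k >> - << l >> : {malg R[K]}).
Proof.
move=> /negPf neq; rewrite -mcoeff_neq0 mcoeffB !mcoeffU eqxx neq subr0.
exact: oner_neq0.
Qed.

Lemma msupp_malgUB_le (K : monomType) (R : nzRingType) (k l n : K) :
  n \in msupp (<< k >> - << l >> : {malg R[K]}) -> n = k \/ n = l.
Proof.
move/(fsubsetP (msuppB_le _ _)); rewrite in_fsetU !msuppU1 !in_fset1.
by case/predU1P=> [|/eqP]; [left|right].
Qed.

Lemma dsigmaUU (F : fieldType) (sigma : {rmorphism F -> F}) c m :
  dsigma sigma << c *g m >> = << sigma c *g mshift m >>.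
Proof.
apply: etrans (mmapU _ _) _; apply: etrans (mul_malgC _ _) _.
exact: scale_malgU.
Qed.

Lemma class_sum_dsigma (F : fieldType) (sigma : {rmorphism F -> F}) C P :
  class_sum C (dsigma sigma P)
    = sigma (class_sum (fun m => C (mshift m)) P).
Proof.
rewrite {1}(monalgE P) raddf_sum class_sum_sum class_sumE rmorph_sum /=.
apply: eq_bigr => m _.
by rewrite dsigmaUU class_sumU rmorphM rmorph_nat.
Qed.

Lemma dpow_dvar (F : fieldType) (sigma : {rmorphism F -> F}) p :
  dpow (dsigma sigma) (dvar F) p = << mon_of p >>.
Proof.
have iter_dvar i : iter i (dsigma sigma) (dvar F) = << ucm i >>.
  by elim: i => [|i IH]; [exact: erefl | rewrite iterS IH; exact: dsigmaU].
have powU i n : exists2 m : {cmonom nat},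
    << ucm i >> ^+ n = << m >> :> dpoly F & forall j, m j = ((i == j) * n)%N.
  elim: n => [|n [m IH eq_m]].
    by exists mone => // j; rewrite cm1 muln0.
  exists (mmul (ucm i) m); first by rewrite exprS IH; exact: malgUM.
  by move=> j; rewrite cmM ucmE eq_m mulnS.
have [m -> eq_m] : exists2 m : {cmonom nat},
    dpow (dsigma sigma) (dvar F) p = << m >>
      & forall j, m j = if (j < size p)%N then (p`_j)%R else 0%N.
  rewrite /dpow; elim: (size p) => [|k [m IH eq_m]].
    by exists mone => [|j]; rewrite ?big_ord0 ?cm1.
  have [n pow_n eq_n] := powU k (p`_k)%R.
  exists (mmul m n).
    by rewrite big_ord_recr /= IH iter_dvar pow_n; exact: malgUM.
  move=> j; rewrite cmM eq_m eq_n ltnS.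
  by case: (ltngtP j k) => [||->]; rewrite ?mul0n ?addn0 ?mul1n.
congr << _ >>; apply/eqP/cmP => j; rewrite eq_m mon_ofE.
by case: ltnP => // /(nth_default _) ->.
Qed.

(** The generator y^(g^+) - y^(g^-), written with its two monomials. *)
Definition binom_of (F : fieldType) (g : {poly int}) : dpoly F :=
  << pmon g >> - << pmon (- g) >>.

Lemma dpow_dvarB (F : fieldType) (sigma : {rmorphism F -> F}) g :
  dpow (dsigma sigma) (dvar F) (pos_part g)
    - dpow (dsigma sigma) (dvar F) (neg_part g) = binom_of F g.
Proof. by congr (_ - _); exact: dpow_dvar. Qed.

Lemma class_sum_binom (F : fieldType) C g :
  class_sum C (binom_of F g) = (C (pmon g))%:R - (C (pmon (- g)))%:R.
Proof.
apply: etrans (class_sumB _ _ _) _.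
by congr (_ - _); apply: etrans (class_sumU _ _ _) (mul1r _).
Qed.

Lemma binom_in_ideal (F : fieldType) (sigma : {rmorphism F -> F}) L g :
  L g -> 0 < lead_coef g -> lattice_sigma_ideal sigma L (binom_of F g).
Proof.
move=> Lg g0 I _ genI; apply: genI; exists g; split=> //.
exact: esym (dpow_dvarB _ _).
Qed.

(* Polynomials all of whose class sums vanish form a sigma-ideal, and it contains
   the generators. *)
Lemma lattice_ideal_class_sum (F : fieldType) (sigma : {rmorphism F -> F}) L P
    C : zideal L -> saturated L C ->
  lattice_sigma_ideal sigma L P -> class_sum C P = 0.
Proof.
(* [C] is generalised: products with a monomial and the shift replace it by a preimage, which is
   again saturated. *)
move=> LI + IP; move: C.
have [_ _ LM] := LI.
apply: (IP (fun P => forall C, saturated L C -> class_sum C P = 0)) => [|Q].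
  split=> [C _|P1 P2 P10 P20 C satC|P1 P2 P20 C satC|P1 P10 C satC].
  - exact: mmap0.
  - by rewrite class_sumD P10 ?P20 ?addr0.
  - rewrite class_sumM big1_seq // => m _; rewrite P20 ?mulr0 // => n n' Ln.
    by apply: satC; rewrite !pol_ofM opprD addrACA subrr add0r.
  - rewrite class_sum_dsigma P10 ?rmorph0 // => n n' Ln.
    by apply: satC; rewrite !pol_of_shift -mulrBr; apply: LM.
case=> g [Lg _ ->] C satC; rewrite dpow_dvarB class_sum_binom.
by rewrite (satC _ (pmon (- g))) ?pmonB ?subrr.
Qed.

(** The coefficients over the class of [m] cancel, so [P] has another monomial [n] in that class. It
    is smaller than [m], and the positive part of their difference is at most [m]. *)
Lemma lattice_ideal_LM (F : fieldType) (sigma : {rmorphism F -> F}) L P m :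
    zideal L -> lattice_sigma_ideal sigma L P -> is_LM P m ->
  exists g, [/\ L g, 0 < lead_coef g & forall i, (pmon g i <= m i)%N].
Proof.
move=> LI IP [mP maxm]; have [L0 LD _] := LI.
pose C (n : {cmonom nat}) := `[< L (pol_of m - pol_of n) >].
have satC : saturated L C.
  move=> n n' Ln; apply: asbool_equiv_eq; split=> H.
    by move: (LD _ _ H Ln); rewrite addrA subrK.
  by move: (zidealB LI H Ln); rewrite opprB addrA subrK.
have := lattice_ideal_class_sum LI satC IP; rewrite class_sumE => sum0.
have [[n [nP neq Cn]]|no_n] :=
    pselect (exists n, [/\ n \in msupp P, n != m & C n]).
  have [/eqP|/mnm_ltP lt_nm] := maxm n nP; first by rewrite (negPf neq).
  exists (pol_of m - pol_of n); split=> // [|i]; first exact/asboolP.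
  have := pmonE (pol_of m - pol_of n) i; rewrite coefB !coef_pol_of.
  by lia.
(* Otherwise the class sum is the single coefficient at [m], which is nonzero. *)
case/eqP: (oner_neq0 F); move: sum0; rewrite (big_fsetD1 m) //=.
rewrite big1_fset ?addr0.
  have -> : C m by apply/asboolP; rewrite subrr.
  by move/eqP; rewrite mulr1 mcoeff_eq0 mP.
move=> n; rewrite in_fsetD1 => /andP[neq nP] _.
by case Cn : (C n); rewrite ?mulr0 //; case: no_n; exists n.
Qed.

Lemma exists_LM (F : fieldType) (P : dpoly F) : P != 0 -> exists m, is_LM P m.
Proof.
rewrite -msupp_eq0 => /fset0Pn[m0 m0P].
have max_seq (s : seq {cmonom nat}) m1 : exists2 m, m \in m1 :: s &
    forall n, n \in m1 :: s -> n = m \/ mnm_lt n m.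
  elim: s m1 => [|m2 s IH] m1.
    by exists m1 => [|n]; rewrite inE // => /eqP; left.
  have [m ms maxm] := IH m2.
  have [->|neq] := eqVneq m1 m.
    exists m; rewrite ?mem_head // => n; rewrite inE => /predU1P[->|/maxm //].
    by left.
  case: (mnm_lt_total neq) => lt.
    exists m; first by rewrite inE ms orbT.
    by move=> n; rewrite inE => /predU1P[->|/maxm //]; right.
  exists m1; first exact: mem_head.
  move=> n; rewrite inE => /predU1P[->|/maxm [->|ltn]]; first by left.
    by right.
  by right; apply: mnm_lt_trans lt.
have [m ms maxm] := max_seq (msupp P) m0.
exists m; split=> [|n nP]; last by apply: maxm; rewrite inE nP orbT.
by move: ms; rewrite inE => /predU1P[->|].
Qed.

Lemma binom_LM (F : fieldType) g :
  0 < lead_coef g -> is_LM (binom_of F g) (pmon g).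
Proof.
move=> g0; have lt_g : mnm_lt (pmon (- g)) (pmon g).
  by apply/mnm_ltP; rewrite pmonB.
have neq : pmon (- g) != pmon g.
  by apply/eqP => eq_g; move: lt_g; rewrite eq_g; apply: mnm_lt_irr.
split; first exact: msupp_malgUB.
by move=> n /msupp_malgUB_le[->|->]; [left|right].
Qed.

Lemma is_LM_neq0 (F : fieldType) (P : dpoly F) m : is_LM P m -> P != 0.
Proof. by case=> mP _; rewrite -msupp_eq0; apply/fset0Pn; exists m. Qed.

Lemma is_LM_inj (F : fieldType) (P : dpoly F) m n :
  is_LM P m -> is_LM P n -> m = n.
Proof.
move=> [mP maxm] [nP maxn]; case: (maxm n nP) => [//|lt_nm].
case: (maxn m mP) => [//|/(mnm_lt_trans lt_nm)].
by move/mnm_lt_irr.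
Qed.

(** * Leading coefficients in an ideal of Z[x] *)

Lemma dvdz_le (d n : int) : 0 < n -> (d %| n)%Z -> d <= n.
Proof.
rewrite dvdzE => n0 /dvdn_leq le_dn.
by have := le_dn ltac:(lia); lia.
Qed.

Lemma size_coef_gt0 (h : {poly int}) k :
  0 < h`_k -> (forall j, (k < j)%N -> h`_j = 0) -> size h = k.+1.
Proof.
move=> hk0 hk; apply/eqP; rewrite eqn_leq; apply/andP; split.
  by apply/leq_sizeP=> j; apply: hk.
by rewrite ltnNge; apply: contraTN hk0 => /(nth_default 0)->.
Qed.

(** If [g] had smaller degree, [g - f] would have the negative leading coefficient
    [- lead_coef f]. *)
Lemma size_zlt (f g : {poly int}) :
  0 < lead_coef f -> zlt f g -> (size f <= size g)%N.
Proof.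
move=> f0; rewrite leqNgt; apply: contraL => lt_gf.
by rewrite /zlt addrC lead_coefDl ?size_polyN // lead_coefN oppr_gt0 -leNgt ltW.
Qed.

Lemma size_last_zlt (G : seq {poly int}) g :
    sorted zlt G -> (forall h, h \in G -> 0 < lead_coef h) -> g \in G ->
  (size g <= size (last 0%R G))%N.
Proof.
case: G => // h G /=; elim: G h g => [|k G IH] h g /=.
  by move=> _ _; rewrite inE => /eqP->.
case/andP=> hk kG G0; rewrite inE => /predU1P[->|gG].
  apply: leq_trans (size_zlt (G0 _ (mem_head _ _)) hk) _.
  apply: (IH k) => [||]; rewrite ?mem_head // => l lG.
  by apply: G0; rewrite inE lG orbT.
by apply: (IH k) => // l lG; apply: G0; rewrite inE lG orbT.
Qed.

Lemma lead_coef_lt_of h : lead_coef (lt_of h) = lead_coef h.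
Proof. by rewrite lead_coefZ lead_coefXn mulr1. Qed.

Lemma zdvd_lead_coef f g :
  zdvd (lt_of g) (lt_of f) -> (lead_coef g %| lead_coef f)%Z.
Proof.
case=> r /(congr1 lead_coef); rewrite lead_coefM !lead_coef_lt_of => ->.
exact: dvdz_mull.
Qed.

Lemma size_lt_of h : size (lt_of h) = size h.
Proof.
have [->|h0] := eqVneq h 0; first by rewrite /lt_of lead_coef0 scale0r.
rewrite size_scale ?lead_coef_eq0 // size_polyXn prednK //.
by rewrite size_poly_gt0.
Qed.

Lemma zdvd_size f g :
  f != 0 -> zdvd (lt_of g) (lt_of f) -> (size g <= size f)%N.
Proof.
move=> f0 [r eq_r]; have rg0 : r * lt_of g != 0.
  by rewrite -eq_r -size_poly_eq0 size_lt_of size_poly_eq0.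
rewrite -size_lt_of -(size_lt_of f) eq_r; move: rg0.
rewrite mulf_eq0 negb_or => /andP[r0 g0]; rewrite size_mul //.
move: r0; rewrite -size_poly_gt0; case: (size r) => // n _.
by rewrite addSn leq_addl.
Qed.

(** A converse to the two preceding facts: divisibility of leading terms amounts to comparing
    degrees and dividing leading coefficients. *)
Lemma zdvd_lt_of (f g : {poly int}) : g != 0 -> (size g <= size f)%N ->
  (lead_coef g %| lead_coef f)%Z -> zdvd (lt_of g) (lt_of f).
Proof.
move=> g0 le_gf /dvdzP[z lc_f]; exists (z *: 'X^((size f).-1 - (size g).-1)).
rewrite /lt_of lc_f -scalerAl -scalerAr scalerA -exprD subnK //.
by move: le_gf; case: (size g); case: (size f).
Qed.

(* A Bezout combination of the leading coefficients of [h] and [last 0 G] is the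
   leading coefficient of an element of the ideal whose degree is that of
   [last 0 G]; by reducedness only [last 0 G] itself can divide its leading
   term. *)
Lemma reduced_lead_coef_dvd G f :
    sorted zlt G -> reduced_groebner (ideal_gen G) G -> ideal_gen G f ->
  (lead_coef (last 0%R G) %| lead_coef f)%Z.
Proof.
move=> sortG [[[f1 Lf1 f10] G0 dvdG] redG].
have LI := ideal_gen_zideal G; have [_ LD LM] := LI.
set g := last 0 G.
have gG : g \in G.
  have [g1] := dvdG f1 Lf1 f10.
  by rewrite /g; case: (G) => //= h s _ _; apply: mem_last.
have dvd_g h : h \in G -> (lead_coef g %| lead_coef h)%Z.
  move=> hG; have [Lg g0] := G0 g gG; have [Lh h0] := G0 h hG.
  have [u [v bez]] := Bezoutz (lead_coef h) (lead_coef g).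
  have le_hg : (size h <= size g)%N.
    by apply: size_last_zlt => // k /G0[].
  set d := gcdz _ _ in bez.
  have d0 : 0 < d by rewrite lt_neqAle eq_sym gcdz_eq0 negb_and gt_eqF.
  pose k := u%:P * ('X^(size g - size h) * h) + v%:P * g.
  have sz0 (p : {poly int}) : 0 < lead_coef p -> (0 < size p)%N.
    by move=> p0; rewrite size_poly_gt0 -lead_coef_eq0 gt_eqF.
  have [sh sg] := (sz0 _ h0, sz0 _ g0).
  have kd : k`_(size g).-1 = d.
    rewrite coefD !coefCM coefXnM ifN; last by rewrite -leqNgt; lia.
    rewrite -bez !lead_coefE; congr (u * _`__ + _); lia.
  have k0 j : ((size g).-1 < j)%N -> k`_j = 0.
    move=> ltj; rewrite coefD !coefCM coefXnM ifN; last by rewrite -leqNgt; lia.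
    rewrite !nth_default ?mulr0 ?addr0 //; move: ltj le_hg sh sg;
      by move: (size g) (size h); lia.
  have sk : size k = (size g).-1.+1 by apply: size_coef_gt0; rewrite ?kd.
  have lk : lead_coef k = d by rewrite lead_coefE sk.
  have Lk : ideal_gen G k by apply: (LD); do !apply: (LM).
  have nzk : k != 0 by rewrite -lead_coef_eq0 lk gt_eqF.
  have [l lG dvd_lk] := dvdG k Lk nzk.
  have dvd_lc := zdvd_lead_coef dvd_lk; rewrite lk in dvd_lc.
  have [eq_gl|neq] := eqVneq g l.
    by rewrite eq_gl; apply: dvdz_trans dvd_lc (dvdz_gcdl _ _).
  (* [lead_coef l] divides the gcd, hence [lead_coef g], and [l] has degree at most that of [g]: its
     leading term would divide that of [g]. *)
  have [] := redG g l gG lG neq; case; apply: zdvd_lt_of.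
  - by have [_ l0] := G0 l lG; rewrite -lead_coef_eq0 gt_eqF.
  - by rewrite -(prednK sg) -sk; apply: zdvd_size.
  - exact: dvdz_trans dvd_lc (dvdz_gcdr _ _).
move=> Lf; have [->|f0] := eqVneq f 0; first by rewrite lead_coef0 dvdz0.
have [h hG dvd_hf] := dvdG f Lf f0.
exact: dvdz_trans (dvd_g h hG) (zdvd_lead_coef dvd_hf).
Qed.

(** * Finite bases and elements of Phi_0 *)

Lemma Phi0P f : 0 < lead_coef f ->
  Phi0 f <-> forall i, (i < (size f).-1)%N -> pmon f i = 0%N.
Proof.
move=> f0.
have eq_lt i : (lt_of f)`_i = lead_coef f *+ (i == (size f).-1).
  by rewrite coefZ coefXn mulr_natr.
have eq_map i : (map_poly Posz (pos_part f))`_i = (pmon f i)%:Z.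
  by rewrite coef_map_id0 // mon_ofE.
split=> [/polyP eq_f i lti|eq0].
  by have := eq_f i; rewrite eq_lt eq_map; case: eqP; lia.
apply/polyP => i; rewrite eq_lt eq_map.
case: (ltngtP i (size f).-1) => [/eq0->//|lti|->].
  by rewrite pmonE nth_default //; move: lti; case: (size f).
by rewrite pmonE -lead_coefE; move: f0; move: (lead_coef f); lia.
Qed.

Lemma pmon_deg f : 0 < lead_coef f ->
  (pmon f (size f).-1)%:Z = lead_coef f.
Proof.
by move=> f0; rewrite pmonE -lead_coefE; move: (lead_coef f) f0; lia.
Qed.

Lemma pmon_gt_deg (f : {poly int}) i : ((size f).-1 < i)%N -> pmon f i = 0%N.
Proof.
move=> lti; have := pmonE f i; rewrite nth_default; first by lia.
by move: lti; case: (size f).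
Qed.

(* Elements of degree at least that of [f] are divisible by a shift of the
   monomial of [f]; Dickson's lemma takes care of the remaining ones. *)
Lemma finite_basis_of_Phi0 (F : fieldType) (sigma : {rmorphism F -> F}) L f :
    zideal L -> L f -> 0 < lead_coef f -> Phi0 f ->
    (forall h, L h -> (lead_coef f %| lead_coef h)%Z) ->
  exists H : seq (dpoly F),
    sigma_groebner (lattice_sigma_ideal sigma L) (fun h => h \in H).
Proof.
move=> LI Lf f0 /(Phi0P f0) Phif dvdL.
(* For such [g] the exponents of [pmon g] from [size f] on vanish, so Dickson's lemma in [size f]
   variables suffices. *)
pose Q g := [/\ L g, 0 < lead_coef g & (size g <= size f)%N].
have [s [sQ sdom]] := dickson pmon (size f) Q.
exists [seq binom_of F g | g <- f :: s]; split.
  move=> _ /mapP[g + ->]; rewrite inE => /predU1P[->|/sQ[Lg g0 _]];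
    exact: binom_in_ideal.
move=> P IP P0; have [m LMm] := exists_LM P0.
have [g [Lg g0 le_gm]] := lattice_ideal_LM LI IP LMm.
have [le_gf|lt_fg] := leqP (size g) (size f).
  have [h hs le_hg] := sdom g (And3 Lg g0 le_gf); have [_ h0 le_hf] := sQ h hs.
  exists (binom_of F h), (pmon h), m, 0%N; split=> //.
  - by apply: map_f; rewrite inE hs orbT.
  - exact: binom_LM.
  - apply/mnm_dvdP => i; have [lti|lei] := ltnP i (size f).
      exact: leq_trans (le_hg i lti) (le_gm i).
    rewrite pmon_gt_deg //; apply: leq_trans lei.
    apply: leq_ltn_trans (_ : _ <= (size f).-1)%N _.
      by rewrite -!subn1 leq_sub2r.
    by rewrite prednK // size_poly_gt0 -lead_coef_eq0 gt_eqF.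
(* This shift moves the only exponent of [pmon f] to the degree of [g], where [lead_coef f] divides,
   hence is at most, [lead_coef g]. *)
exists (binom_of F f), (pmon f), m, (size g - size f)%N; split=> //.
- exact: map_f (mem_head _ _).
- exact: binom_LM.
have sf : (0 < size f)%N by rewrite size_poly_gt0 -lead_coef_eq0 gt_eqF.
apply/mnm_dvdP => i; apply: leq_trans (le_gm i).
rewrite iter_mshift; case: ltnP => // lei.
have [lti|lti|eqi] := ltngtP (i - (size g - size f))%N (size f).-1.
- by rewrite Phif.
- by rewrite pmon_gt_deg.
have -> : i = (size g).-1 by lia.
have -> : ((size g).-1 - (size g - size f) = (size f).-1)%N by lia.
rewrite -lez_nat !pmon_deg //; apply: dvdz_le => //; exact: dvdL.
Qed.

(* The coefficients are made nonpositive from the top down, by subtracting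
   multiples of ['X^i * g]. *)
Lemma nonpos_tail L g N :
    zideal L -> L g -> 0 < lead_coef g -> ((size g).-1 <= N)%N ->
  exists h, [/\ L h, h`_N = lead_coef g, forall j, (N < j)%N -> h`_j = 0
    & forall e, ((size g).-1 <= e < N)%N -> h`_e <= 0].
Proof.
move=> LI Lg g0 leN; have [_ _ LM] := LI; set d := (size g).-1 in leN *.
have gd j : (d < j)%N -> g`_j = 0.
  by move=> ltj; apply: nth_default; move: ltj; rewrite /d; case: (size g).
suff tail k : exists h, [/\ L h, h`_N = lead_coef g,
    forall j, (N < j)%N -> h`_j = 0
    & forall e, (d <= e < N)%N -> (N - k <= e)%N -> h`_e <= 0].
  have [h [Lh hN h0 h_le0]] := tail N; exists h; split=> // e.
  by move/h_le0; apply; rewrite subnn.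
elim: k => [|k [h [Lh hN h0 h_le0]]].
  exists ('X^(N - d) * g); split=> [||j ltj|e]; first exact: LM.
  - rewrite coefXnM ifN; last by rewrite -leqNgt; lia.
    by rewrite lead_coefE; congr (_`__); lia.
  - by rewrite coefXnM ifN ?gd //; lia.
  - by lia.
(* Below [d], or once the truncated subtraction has reached 0, no new exponent has to be treated. *)
have [lt_kd|le_dk] := ltnP (N - k.+1) d; last have [leNk|ltkN] := leqP N k.
- by exists h; split=> // e de le_e; apply: h_le0 => //; lia.
- by exists h; split=> // e de le_e; apply: h_le0 => //; lia.
set e0 := (N - k.+1)%N in le_dk *.
(* Large enough because [lead_coef g] is at least 1; the subtracted multiple has degree at most
   [e0], so higher coefficients stay. *)
pose z : int := `|h`_e0|.
have coef_h' j : (h - z%:P * ('X^(e0 - d) * g))`_j =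
    h`_j - z * (if (j < e0 - d)%N then 0 else g`_(j - (e0 - d))).
  by rewrite coefB coefCM coefXnM.
exists (h - z%:P * ('X^(e0 - d) * g)); split.
- by apply: (zidealB LI Lh); apply: (LM); apply: (LM).
- rewrite coef_h' ifN ?gd ?mulr0 ?subr0 //; lia.
- move=> j ltj; rewrite coef_h' ifN ?gd ?mulr0 ?subr0 ?h0 //; lia.
move=> e le_e; rewrite leq_eqVlt => /predU1P[<-|lte].
  rewrite coef_h' ifN; last by rewrite -leqNgt leq_subr.
  rewrite (_ : e0 - (e0 - d) = d)%N ?subKn // -lead_coefE /z.
  by move: (h`_e0) (lead_coef g) g0; nia.
rewrite coef_h' ifN ?gd ?mulr0 ?subr0; try lia.
by apply: h_le0 => //; lia.
Qed.

(** Finitely many monomials involve finitely many variables; a zero element of [H] has no leading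
    monomial and imposes no bound. *)
Lemma finite_LM_bound (F : fieldType) (H : seq (dpoly F)) :
  exists D, forall h m i, h \in H -> is_LM h m -> (D < i)%N -> m i = 0%N.
Proof.
have mon_bound (m : {cmonom nat}) : exists D, forall i, (D < i)%N -> m i = 0%N.
  exists (\max_(i <- finsupp m) i) => i lti; apply/eqP; apply/contraTT: lti.
  by rewrite -mem_finsupp -leqNgt => im; apply: leq_bigmax_seq.
elim: H => [|h H [D boundD]]; first by exists 0%N.
have [[m LMm]|no_m] := pselect (exists m, is_LM h m).
  have [E boundE] := mon_bound m; exists (maxn D E) => k n i.
  rewrite gtn_max inE => /predU1P[->|kH] LMn /andP[ltD ltE].
    by rewrite (is_LM_inj LMn LMm) boundE.
  exact: boundD LMn ltD.
exists D => k n i; rewrite inE => /predU1P[->|kH] LMn; last exact: boundD LMn.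
by case: no_m; exists n.
Qed.

(* The test element [h'] has leading term [lead_coef g *: 'X^N], nonpositive
   coefficients at the exponents in [d, N), and a positive part below [d]
   dividing the irreducible monomial [v].  Hence a shift by [k] of a basis
   monomial dividing its leading monomial must reach the exponent [N]; as [N] is
   large, it stays above [d], where only the exponent [N] is left. *)
Lemma Phi0_of_finite_basis (F : fieldType) (sigma : {rmorphism F -> F}) L g
    (H : seq (dpoly F)) :
    zideal L -> L g -> 0 < lead_coef g ->
    (forall h, L h -> (lead_coef g %| lead_coef h)%Z) ->
    sigma_groebner (lattice_sigma_ideal sigma L) (fun h => h \in H) ->
  exists f, [/\ L f, lead_coef f = lead_coef g & Phi0 f].
Proof.
move=> LI Lg g0 dvdL [HI gbH]; have [L0 LD LM] := LI.
have [D boundD] := finite_LM_bound H.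
(* A shift that moves an exponent at most [D] to [N] is by more than [d]. *)
set d := (size g).-1; pose N := (d + D).+1.
have [h [Lh hN h_gt h_le0]] : exists h, [/\ L h, h`_N = lead_coef g,
    forall j, (N < j)%N -> h`_j = 0
    & forall e, (d <= e < N)%N -> h`_e <= 0].
  by apply: nonpos_tail => //; rewrite /N /d; lia.
pose u := pmon (take_poly d h).
have u_ge j : (d <= j)%N -> u j = 0%N.
  move=> lej; have := pmonE (take_poly d h) j.
  by rewrite coef_take_poly ltnNge lej /u /=; lia.
have Lu : L (pol_of u - pol_of u) by rewrite subrr.
(* The normal form of [u]: the least monomial in its class modulo [L]. *)
have [v [Lv v_ge minv]] :=
  mnm_lt_min (P := fun w => L (pol_of w - pol_of u)) Lu u_ge.
(* Otherwise [v - k] would be the exponent polynomial of a smaller monomial in the same class. *)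
have irred k : L k -> 0 < lead_coef k -> ~ forall i, (pmon k i <= v i)%N.
  move=> Lk k0 le_kv.
  pose w := pmon (pol_of v - k).
  have eq_w : pol_of w = pol_of v - k.
    apply/polyP => i; rewrite coef_pol_of pmonE coefB coef_pol_of.
    by have := pmonE k i; have := le_kv i; move: (k`_i); lia.
  apply: (minv w); rewrite ?mnm_ltP eq_w; last by rewrite opprB addrC subrK.
  by rewrite addrAC; apply: zidealB.
(* Below [d] the positive part of [h] is replaced by [v], so the coefficients are at most those of
   [v]; from [d] on nothing changes. *)
pose h' := h + (pol_of v - pol_of u).
have Lh' : L h' by apply: LD.
have h'_ge j : (d <= j)%N -> h'`_j = h`_j.
  by move=> lej; rewrite !coefD coefN !coef_pol_of v_ge ?u_ge // subrr addr0.
have h'N : h'`_N = lead_coef g by rewrite h'_ge // /N; lia.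
have sh' : size h' = N.+1.
  apply: size_coef_gt0; first by rewrite h'N.
  move=> j ltj; have ledj : (d <= j)%N by move: ltj; rewrite /N; lia.
  by rewrite h'_ge ?h_gt.
have lh' : lead_coef h' = lead_coef g by rewrite lead_coefE sh'.
have h'0 : 0 < lead_coef h' by rewrite lh'.
have pmon_lt i : (i < d)%N -> (pmon h' i <= v i)%N.
  move=> lti; have := pmonE h' i; have := pmonE (take_poly d h) i.
  rewrite coef_take_poly lti !coefD coefN !coef_pol_of -/u.
  by move: (h`_i) (v i) (u i); lia.
have pmon_mid i : (d <= i < N)%N -> pmon h' i = 0%N.
  case/andP=> lei lti; have := pmonE h' i; rewrite h'_ge //.
  by have := h_le0 i; rewrite lei lti => /(_ isT); move: (h`_i); lia.
have pmon_gt i : (N < i)%N -> pmon h' i = 0%N.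
  by move=> lti; rewrite pmon_gt_deg // sh'.
have LMh' := binom_LM F h'0.
have [p [m [n [k [pH LMm LMn dvd_mn]]]]] :=
  gbH _ (binom_in_ideal Lh' h'0) (is_LM_neq0 LMh').
move: dvd_mn; rewrite (is_LM_inj LMn LMh') => /mnm_dvdP dvd_mh.
have [f [Lf f0 le_fm]] := lattice_ideal_LM LI (HI _ pH) LMm.
have le_fh i : (pmon f i <= pmon h' (i + k))%N.
  apply: leq_trans (le_fm i) _; have := dvd_mh (i + k)%N.
  by rewrite iter_mshift ltnNge leq_addl addnK.
have fd := pmon_deg f0; set e := (size f).-1 in fd.
have fe0 : (0 < pmon f e)%N by rewrite -ltz_nat fd.
have ek_le : (e + k <= N)%N.
  rewrite leqNgt; apply/negP => /pmon_gt eq0; have := le_fh e.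
  by rewrite eq0; move: fe0; lia.
have le_eD : (e <= D)%N.
  rewrite leqNgt; apply/negP => /(boundD _ _ _ pH LMm) eq0.
  by have := le_fm e; rewrite eq0; move: fe0; lia.
have ek : (e + k = N)%N.
  apply/eqP; rewrite eqn_leq ek_le leqNgt; apply/negP => lt_ek.
  (* If the shifted [f] ended before [N], its positive part would lie within [v]. *)
  case: (irred ('X^k * f)); first exact: LM.
    by rewrite lead_coefM lead_coefXn mul1r.
  move=> i; rewrite pmonMXn; case: ltnP => // lei.
  have := le_fh (i - k)%N; rewrite subnK //.
  have [ltid|leid] := ltnP i d.
    by move=> le1; apply: leq_trans le1 (pmon_lt i ltid).
  have [ltiN|leNi] := ltnP i N.
    by rewrite pmon_mid ?leid // leqn0 => /eqP->.
  by rewrite pmon_gt_deg // -/e; lia.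
exists f; split=> //.
  have := le_fh e; rewrite ek -lez_nat fd (_ : (pmon h' N)%:Z = lead_coef g).
    move=> le_fg; apply/eqP; rewrite eq_le le_fg /=.
    by apply: dvdz_le => //; apply: dvdL.
  by rewrite -lh' -(pmon_deg h'0) sh'.
(* The lower exponents of [f] are shifted into the gap from [d] to [N], where [h'] has no positive
   coefficient. *)
apply/(Phi0P f0) => i lti; apply/eqP; rewrite -leqn0.
apply: leq_trans (le_fh i) _; rewrite pmon_mid // -ek ltn_add2r lti andbT.
by move: ek le_eD; rewrite /N; lia.
Qed.

Theorem theorem3p10 (F : fieldType) (sigma : {rmorphism F -> F})
    (G : seq {poly int}) :
  sorted zlt G ->
  reduced_groebner (ideal_gen G) G ->
  (exists H : seq (dpoly F),
     sigma_groebner (lattice_sigma_ideal sigma (ideal_gen G))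
       (fun h => h \in H))
  <->
  (exists f : {poly int},
     [/\ ideal_gen G f, lead_coef f = lead_coef (last 0 G) & Phi0 f]).
Proof.
move=> sortG redG; have LI := ideal_gen_zideal G.
have dvdL f : ideal_gen G f -> (lead_coef (last 0%R G) %| lead_coef f)%Z.
  exact: reduced_lead_coef_dvd.
(* The ideal has a nonzero element, whose leading term has a divisor from [G]; so [G] is nonempty
   and the default 0 is not reached. *)
have [Lg g0] : ideal_gen G (last 0%R G) /\ 0 < lead_coef (last 0%R G).
  case: redG => -[[f Lf f0] G0 dvdG] _; apply: G0; have [g] := dvdG f Lf f0.
  by case: (G) => //= h s _ _; apply: mem_last.
split=> [[H gbH]|[f [Lf lc_f Phif]]]; first exact: Phi0_of_finite_basis gbH.
by apply: finite_basis_of_Phi0 Lf _ Phif _; rewrite ?lc_f.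
Qed.
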